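(* There is an absolute constant $C_1>0$ such that the following holds. Let $n,m,d\ge1$ be integers with $m\le 2n$, let $T>0$, and let $\mu$ be a Borel probability distribution on $\mathbb{R}^d$. Let $x_1,\dots,x_m$ be i.i.d. points drawn from $\mu$, and let $\varepsilon_1,\dots,\varepsilon_m$ be independent Rademacher random variables (uniform on $\{-1,1\}$), independent of $x_1,\dots,x_m$. Then there is an online algorithm that discards some of the $x_i$'s such that the expected number of discarded points is at most $2n/T$, and $$\mathbb{E}\sup_{B,\ 1\le k\le m}\operatorname{disc}_k(B)\le T\,(\log_2 n)^{2d}+d\ln(dn)+C_1 d,$$ where the supremum is over all boxes $B=(-\infty,b_1]\times\cdots\times(-\infty,b_d]$ with $b_1,\dots,b_d\in\mathbb{R}$ and all $k=1,\dots,m$, and where $$\operatorname{disc}_k(B)=\Big|\sum_{1\le i\le k,\ x_i\text{ retained}}\varepsilon_i\,\mathbf{1}_{\{x_i\in B\}}\Big|$$ is the sign discrepancy of the retained points.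
   Context: Online algorithm: the signed points $(x_i,\varepsilon_i)$ arrive one at a time, $i=1,\dots,m$. At time $i$ the algorithm decides whether to retain or discard $x_i$ on the basis of the current signed point $(x_i,\varepsilon_i)$, the previously retained signed points, and its own internal randomness (which is independent of all the $x_j$ and $\varepsilon_j$); the decision is never reversed in the future. Expectations are over the points, the signs, and the internal randomness of the algorithm. *)

(* Defs.v *)
From HB Require Import structures.
From mathcomp Require Import all_boot all_order all_algebra.
From mathcomp Require Import all_classical all_reals all_analysis.

Set Implicit Arguments.
Unset Strict Implicit.
Unset Printing Implicit Defensive.

Import Order.TTheory GRing.Theory Num.Theory.
Import numFieldNormedType.Exports.

Local Open Scope classical_set_scope.
Local Open Scope ring_scope.

Notation borelRV R d := (g_sigma_algebraType (@open 'rV[R]_d)).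

Notation signed_point R d := (borelRV R d * R)%type.

Definition mutually_independent (R : realType) (d d' : measure_display)
    (Omega : measurableType d) (T : measurableType d') (P : probability Omega R)
    (I : finType) (X : I -> Omega -> T) : Prop :=
  forall A : I -> set T, (forall i, measurable (A i)) ->
    (P (\bigcap_(i in [set: I]) (X i @^-1` A i)) =
     \prod_(i : I) P (X i @^-1` A i))%E.

Definition independent (R : realType) (d d1 d2 : measure_display)
    (Omega : measurableType d) (T1 : measurableType d1) (T2 : measurableType d2)
    (P : probability Omega R) (X : Omega -> T1) (Y : Omega -> T2) : Prop :=
  forall (A : set T1) (B : set T2), measurable A -> measurable B ->
    P (X @^-1` A `&` Y @^-1` B) = (P (X @^-1` A) * P (Y @^-1` B))%E.

(* Only measurable sets are tested: the value of a measure outside the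
   sigma-algebra carries no information. *)
Definition has_law (R : realType) (d d' : measure_display)
    (Omega : measurableType d) (T : measurableType d') (P : probability Omega R)
    (X : {RV P >-> T}) (mu : probability T R) : Prop :=
  forall A : set T, measurable A -> distribution P X A = mu A.

Definition rademacher (R : realType) (d : measure_display)
    (Omega : measurableType d) (P : probability Omega R)
    (e : {RV P >-> R}) : Prop :=
  P (e @^-1` [set 1]) = (2^-1)%:E /\ P (e @^-1` [set -1]) = (2^-1)%:E.

(* [decide A i w h p] is true iff, at time i (times start at 0), with internal
   randomness w, the signed point p is retained when h lists, in order of
   arrival, the signed points retained so far.  Measurability in (w, h, p) is
   required on histories of each fixed length k. *)
Record online_algorithm (R : realType) (d : nat) := OnlineAlgorithm {
  rand_display : measure_display ;
  rand_space : measurableType rand_display ;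
  rand_law : probability rand_space R ;
  decide : nat -> rand_space -> seq (signed_point R d) -> signed_point R d -> bool ;
  measurable_decide : forall i k : nat,
    measurable_fun [set: rand_space * k.-tuple (signed_point R d) * signed_point R d]
      (fun z => decide i z.1.1 z.1.2 z.2)
}.

(* The successive decisions on the stream s, received from time i on, when h is
   the list of the signed points retained before time i. *)
Fixpoint decisions_from (R : realType) (d : nat) (A : online_algorithm R d)
    (w : rand_space A) (i : nat) (h s : seq (signed_point R d)) : seq bool :=
  if s is p :: s' then
    let r := decide i w h p in
    r :: decisions_from w i.+1 (if r then rcons h p else h) s'
  else [::].

Definition retained (R : realType) (d m : nat) (A : online_algorithm R d)
    (w : rand_space A) (p : 'I_m -> signed_point R d) (i : 'I_m) : bool :=
  nth false (decisions_from w 0 [::] [seq p j | j <- enum 'I_m]) i.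

Definition discarded_count (R : realType) (d m : nat) (A : online_algorithm R d)
    (w : rand_space A) (p : 'I_m -> signed_point R d) : nat :=
  #|[set i | ~~ retained w p i]%SET|.

Definition box (R : realType) (d : nat) (b : 'rV[R]_d) : set (borelRV R d) :=
  [set y : 'rV[R]_d | forall j, y ord0 j \in `]-oo, b ord0 j]].

Definition disc (R : realType) (d m : nat) (A : online_algorithm R d)
    (w : rand_space A) (p : 'I_m -> signed_point R d) (k : nat)
    (B : set (borelRV R d)) : R :=
  `| \sum_(i < m | (i < k)%N && retained w p i) (p i).2 * \1_B (p i).1 |.

(* An extended real.  By right continuity in b, the supremum may be restricted
   to rational b, so it is measurable in the randomness. *)
Definition sup_disc (R : realType) (d m : nat) (A : online_algorithm R d)
    (w : rand_space A) (p : 'I_m -> signed_point R d) : \bar R :=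
  ereal_sup [set v | exists (b : 'rV[R]_d) (k : nat),
    (1 <= k <= m)%N /\ v = (disc w p k (box b))%:E].

Definition log2 (R : realType) (y : R) : R := ln y / ln 2.

(* Main.v *)
Require Import Defs.
From HB Require Import structures.
From mathcomp Require Import all_boot all_order all_algebra.
From mathcomp Require Import zify ring.
From mathcomp Require Import all_classical all_reals all_analysis.
From mathcomp Require Import measurable_realfun.

Set Implicit Arguments.
Unset Strict Implicit.
Unset Printing Implicit Defensive.

Import Order.TTheory GRing.Theory Num.Theory.
Import numFieldNormedType.Exports.

(* Let L = floor(log2 n) and cut each axis at the 2^L - 1 quantiles of the
   corresponding marginal of mu.  Apart from the points lying, along some axis,
   in the open gap between two consecutive quantiles, a box is a disjoint union
   of at most L^d products of dyadic blocks of cells, and each point lies in at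
   most L^d such products.  The algorithm keeps a counter with values in [0, K],
   K = floor(T L^d), for every product, and retains a point iff adding its sign
   keeps the counters of all the products containing it within [0, K].  Every
   product then has discrepancy at most K, hence the term T (log2 n)^(2d).
   The vector of counters is a symmetric Markov chain, so that the uniform law is
   stationary; started from it, each of the L^d products containing a point
   blocks it with probability at most 1/(K+1).  Averaging over the initial
   vector gives a deterministic one with at most m L^d/(K+1) <= 2n/T expected
   discards.  Finally a gap has mass at most 2^-L even if mu has atoms, so the
   number G of points in it satisfies E e^G <= C1; bounding the largest of the
   2^L <= n such counts along an axis by ln n + sum_G e^(G - ln n) costs
   ln n + C1 per axis. *)

(** * The chain of bounded counters *)

Section Thinning.
Variables (I X : finType) (inc : I -> pred X) (K : nat).

Notation state := {ffun I -> 'I_K.+1}.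
(** [Some (b, x)] is a point of cell [x] whose sign is 1 if [b] holds and -1 otherwise; [I] indexes
    the counters, later the dyadic boxes. *)
Notation code := (option (bool * X)).
Implicit Types (W : state) (q : code) (s : seq code) (b : bool) (x : X).

Definition fits W q : bool :=
  if q is Some (b, x) then
    [forall i, inc i x ==> (if b then W i < K else 0 < W i)]
  else false.
Arguments fits : simpl never.

(** Out of range [inord] returns a junk value; [step] and [mirror] use the result only under
    [fits]. *)
Definition displace W b x : state :=
  [ffun i => if inc i x then inord (if b then (W i).+1 else (W i).-1) else W i].

Definition step W q : state :=
  if q is Some (b, x) then if fits W q then displace W b x else W else W.
Arguments step : simpl never.

Lemma step_stuck W q : ~~ fits W q -> step W q = W.
Proof. by rewrite /step; case: q => [[b x]|] //=; case: ifP. Qed.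

Fixpoint run W s : seq bool :=
  if s is q :: s' then fits W q :: run (step W q) s' else [::].

Lemma size_run W s : size (run W s) = size s.
Proof. by elim: s W => //= q s IHs W; rewrite IHs. Qed.

Lemma displace_at W b x i : fits W (Some (b, x)) -> inc i x ->
  displace W b x i = (if b then (W i).+1 else (W i).-1) :> nat.
Proof.
move=> /forallP/(_ i) + ix; rewrite ffunE ix /=; case: b => Wi; rewrite inordK //.
by rewrite prednK // ltnW.
Qed.

(** A counter just raised is positive and one just lowered is below [K], so the opposite move is
    never blocked. *)
Lemma displaceK W b x : fits W (Some (b, x)) ->
  fits (displace W b x) (Some (~~ b, x)) /\ displace (displace W b x) (~~ b) x = W.
Proof.
move=> Wb.
have back : fits (displace W b x) (Some (~~ b, x)).
  apply/forallP => i; apply/implyP => ix; rewrite displace_at //.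
  move/forallP: Wb => /(_ i); rewrite ix /=; case: b => //= Wi.
  by rewrite prednK // -ltnS.
split=> //; apply/ffunP => i; case: (boolP (inc i x)) => [ix|nix]; last first.
  by rewrite !ffunE (negbTE nix).
apply: val_inj; rewrite /= displace_at // displace_at //.
by move/forallP: Wb => /(_ i); rewrite ix /=; case: b {back} => //= /prednK.
Qed.

Lemma run_signed W s j : nth false (run W s) j -> nth None s j.
Proof.
elim: s j W => [|q s IHs] [|j] W //=; last exact: IHs.
by case: q.
Qed.

Definition mirror x (z : bool * state) : bool * state :=
  if fits z.2 (Some (z.1, x)) then (~~ z.1, displace z.2 z.1 x) else z.

(* The chain is symmetric: after each step, reversing the sign of the step
   undoes it. *)
Lemma mirrorK x : involutive (mirror x).
Proof.
move=> [b W]; rewrite /mirror /=; case: (boolP (fits W _)) => [Wb|/negbTE ->//].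
by have [-> ->] := displaceK Wb; rewrite negbK.
Qed.

(** Stationarity of the uniform law: the new state is the second component of [mirror], a
    permutation of the pairs (sign, state), so each state is reached from exactly two pairs. *)
Lemma sum_step x (f : state -> nat) :
  \sum_(b : bool) \sum_W f (step W (Some (b, x))) = 2 * \sum_W f W.
Proof.
transitivity (\sum_(z : bool * state) f (mirror x z).2).
  rewrite pair_big; apply: eq_bigr => -[b W] _ /=.
  by rewrite /mirror /step /=; case: ifP.
rewrite (reindex_inj (inv_inj (mirrorK x))) /=.
under eq_bigr do rewrite mirrorK.
by rewrite -(pair_big xpredT xpredT (fun _ W => f W)) /= sum_nat_const card_bool.
Qed.

Lemma card_state_at (i : I) (k : 'I_K.+1) :
  K.+1 * #|[pred W : state | W i == k]| = #|{: state}|.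
Proof.
pose F j := if j == i then pred1 k else predT.
rewrite (_ : #|[pred W : state | W i == k]| = #|family F|); last first.
  apply: eq_card => W; apply/idP/idP => [/eqP Wi|/familyP/(_ i)].
    by apply/familyP => j; rewrite /F; case: eqP => // ->; rewrite inE Wi.
  by rewrite /F eqxx !inE.
rewrite card_family foldrE big_image card_ffun card_ord /=.
rewrite (bigD1 i) //= {1}/F eqxx card1 mul1n.
rewrite (eq_bigr (fun=> K.+1)) => [|j ji]; last by rewrite /F (negbTE ji) card_ord.
by rewrite prod_nat_const -expnS cardC1 prednK //; apply/card_gt0P; exists i.
Qed.

Variables (r : nat).
Hypothesis inc_card : forall x, #|[pred i | inc i x]| <= r.

(** A point is blocked only if one of its at most [r] counters sits at the barrier, [K] for a
    positive sign and 0 for a negative one. Each counter does so in a fraction $1/(K+1)$ of the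
    states, and a union bound concludes. *)
Lemma sum_stuck x :
  K.+1 * (\sum_(b : bool) \sum_W ~~ fits W (Some (b, x))) <= 2 * r * #|{: state}|.
Proof.
pose barrier b : 'I_K.+1 := if b then ord_max else ord0.
have stuck b W :
    ~~ fits W (Some (b, x)) <= \sum_(i | inc i x) (W i == barrier b).
  rewrite /fits negb_forall; case: existsP => //= -[i]; rewrite negb_imply.
  case/andP=> ix Wi; rewrite (bigD1 i) //= (_ : W i == _) //.
  apply/eqP/val_inj; case: b Wi => /=.
    by rewrite -leqNgt => KW; apply/eqP; rewrite eqn_leq KW -ltnS ltn_ord.
  by rewrite -eqn0Ngt => /eqP.
rewrite -mulnA -card_bool -sum_nat_const big_distrr /=; apply: leq_sum => b _.
have le_hits : K.+1 * \sum_W ~~ fits W (Some (b, x)) <=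
    K.+1 * \sum_(W : state) \sum_(i | inc i x) (W i == barrier b).
  by rewrite leq_mul2l leq_sum ?orbT.
apply: (leq_trans le_hits).
rewrite exchange_big big_distrr /=.
rewrite (eq_bigr (fun=> #|{: state}|)) => [|i _].
  by rewrite sum_nat_const leq_mul2r inc_card orbT.
rewrite -(card_state_at i (barrier b)).
by rewrite -sum1_card [in RHS]big_mkcond.
Qed.

Lemma big_cons_tuple (T : finType) n (F : n.+1.-tuple T -> nat) :
  \sum_t F t = \sum_a \sum_(t : n.-tuple T) F [tuple of a :: t].
Proof.
rewrite pair_big /= (reindex (fun p : T * n.-tuple T => [tuple of p.1 :: p.2])) //.
exists (fun t => (thead t, [tuple of behead t])) => [[a t] _|t _] /=.
  by rewrite theadE; congr (_, _); apply: val_inj.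
by rewrite -tuple_eta.
Qed.

(** Induction on the points: [sum_stuck] pays for the first one, and [sum_step] makes the state
    uniform again for the others. *)
Lemma sum_discards (xs : seq X) :
  K.+1 * (\sum_W \sum_(e : (size xs).-tuple bool)
             count negb (run W [seq Some z | z <- zip e xs]))
    <= size xs * r * #|{: state}| * 2 ^ size xs.
Proof.
elim: xs => [|x xs IHxs].
  rewrite big1 ?muln0 // => W _; rewrite big1 // => e _.
  by rewrite (tuple0 e).
under eq_bigr do rewrite big_cons_tuple.
under eq_bigr do under eq_bigr do
  rewrite big_split /= sum_nat_const card_tuple card_bool.
under eq_bigr do rewrite big_split /=.
rewrite big_split /= mulnDr (mulSn (size xs)) mulnDl mulnDl leq_add //.
  under eq_bigr do rewrite -big_distrr /=.
  rewrite -big_distrr /= exchange_big mulnCA expnSr [leqRHS]mulnCA.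
  rewrite leq_mul2l (leq_trans (sum_stuck x)) ?orbT //.
  by rewrite -[leqLHS]mulnA mulnC.
rewrite exchange_big /=.
rewrite (sum_step x (fun W => \sum_(e : (size xs).-tuple bool)
  count negb (run W [seq Some z | z <- zip e xs]))).
rewrite mulnCA expnS [leqRHS]mulnCA leq_mul2l.
exact: IHxs.
Qed.

Lemma sum_discards_tuple m (xs : m.-tuple X) :
  K.+1 * (\sum_W \sum_(e : m.-tuple bool)
             count negb (run W [seq Some z | z <- zip e xs]))
    <= m * r * #|{: state}| * 2 ^ m.
Proof. by have := sum_discards xs; rewrite size_tuple. Qed.

Variable R : realDomainType.
Local Open Scope ring_scope.

Definition jump (i : I) q : R :=
  if q is Some (b, x) then (-1) ^+ (~~ b) *+ inc i x else 0.

(** Telescoping: a retained point moves counter [i] by its jump and a discarded one leaves it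
    alone. *)
Lemma balance W s k i :
  \sum_(0 <= j < size s | (j < k)%N && nth false (run W s) j) jump i (nth None s j)
    = (foldl step W (take k s) i)%:R - (W i)%:R :> R.
Proof.
elim: s k W => [|q s IHs] [|k] W /=; rewrite ?big_nil ?subrr //.
- by rewrite big1 ?subrr // => j; rewrite ltn0.
rewrite big_mkcond big_nat_recl //= -big_mkcond /= IHs.
case: ifPn => [|/step_stuck ->]; last by rewrite add0r.
rewrite /step; case: q => [[b x]|] //= Wq; rewrite Wq addrCA; congr (_ + _).
case: (boolP (inc i x)) => ix; last by rewrite ffunE (negbTE ix) mulr0n add0r.
rewrite displace_at //; move/forallP: Wq => /(_ i); rewrite ix mulr1n.
case: b => /= Wi; first by rewrite -natr1 opprD addrCA subrr addr0.
by rewrite -[in RHS](prednK Wi) -natr1 opprD addrC expr1.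
Qed.

(** Both values of the counter in [balance] lie in $[0, K]$. *)
Lemma balance_le W s k i :
  `|\sum_(0 <= j < size s | (j < k)%N && nth false (run W s) j)
      jump i (nth None s j)| <= K%:R.
Proof.
rewrite balance ler_norml lerBrDr lerBlDr.
rewrite (le_trans (_ : _ <= 0)) ?ler0n //=; last first.
  by rewrite addrC subr_le0 ler_nat -ltnS.
by rewrite -natrD ler_nat (leq_trans _ (leq_addr _ _)) // -ltnS.
Qed.

End Thinning.
Arguments fits {I X} inc {K} W q : simpl never.
Arguments step {I X} inc {K} W q : simpl never.
Arguments run {I X} inc {K} W s.

(** * Dyadic decomposition of corners *)

(* The interval [0, k) is cut into one dyadic block per binary digit 1 of k. *)
Lemma dyadic_ltn L c k : (k < 2 ^ L)%N ->
  (c < k)%N = \sum_(l < L) (odd (k %/ 2 ^ l) && ((c %/ 2 ^ l).+1 == k %/ 2 ^ l)) :> nat.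
Proof.
elim: L c k => [|L IHL] c k; first by rewrite ltnS leqn0 => /eqP ->; rewrite big_ord0.
move=> kL; rewrite big_ord_recl /= !divn1.
under eq_bigr do rewrite /bump /= add1n expnS !divnMA !divn2.
have kL2 : (k./2 < 2 ^ L)%N by rewrite ltn_half_double -mul2n -expnS.
rewrite -IHL //.
(* Peeling off the lowest digit: $c<k$ iff the halves compare strictly, or they are equal with [k]
   odd and [c] even. *)
have := odd_double_half c; have := odd_double_half k.
move: (odd c) (odd k) (c./2) (k./2) => [] [] a b <- <- /=; rewrite ?add0n ?add1n; lia.
Qed.

Lemma nat_forall (I : finType) (p : pred I) :
  [forall i, p i] = (\prod_i p i)%N :> nat.
Proof.
case: (boolP [forall i, p i]) => [/forallP pI|].
  by rewrite big1 // => i _; rewrite pI.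
by rewrite negb_forall => /existsP[i /negbTE npi]; rewrite (bigD1 i) //= npi.
Qed.

Section Dyadic.
Variables (d L N : nat).
Hypothesis N2 : N.+1 = (2 ^ L)%N.

Notation cell := {ffun 'I_d -> 'I_N.+1}.
Notation scale := {ffun 'I_d -> 'I_L}.
Notation dbox := (scale * cell)%type.

(* [(l, a)] encodes the product of the dyadic blocks
   [a_j 2^(l_j) <= c_j < (a_j + 1) 2^(l_j)]. *)
Definition in_dbox (B : dbox) (c : cell) : bool :=
  [forall j, c j %/ 2 ^ B.1 j == B.2 j].

(** At a given scale a cell lies in a single box, so a box containing it is determined by its
    scale. *)
Lemma card_in_dbox c : #|[pred B | in_dbox B c]| <= L ^ d.
Proof.
rewrite -[X in _ <= X ^ _]card_ord -[X in _ <= _ ^ X]card_ord -card_ffun.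
apply: (@leq_card_in _ _ fst) => -[l a] [l' a']; rewrite !inE => /forallP /= la.
move=> /forallP /= la' ll'; rewrite -ll' in la' *; congr pair.
by apply/ffunP => j; apply: val_inj; rewrite /= -(eqP (la j)) (eqP (la' j)).
Qed.

(** The block used by [dyadic_ltn] ends at the odd quotient, so its index is one less. If the
    quotient is 0, the predecessor is a default value, excluded by the oddness test in
    [corner_decomposition]. *)
Definition corner (k : cell) (l : scale) : cell :=
  [ffun j => inord (k j %/ 2 ^ l j).-1].

(** The indicator of a corner is a product over the axes; expanding the one-dimensional sums of
    [dyadic_ltn] gives one term per choice of a scale on each axis. *)
Lemma corner_decomposition (c k : cell) :
  [forall j, c j < k j] =
    \sum_(l : scale)
      ([forall j, odd (k j %/ 2 ^ l j)] && in_dbox (l, corner k l) c) :> nat.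
Proof.
rewrite nat_forall.
under eq_bigr => j _ do rewrite (@dyadic_ltn L) -?N2 //.
rewrite bigA_distr_bigA; apply: eq_bigr => l _.
rewrite -nat_forall; congr nat_of_bool.
apply/forallP/andP => [kl|[/forallP kl /forallP cl] j].
  split; apply/forallP => j; have /andP[odd_k /eqP ck] := kl j => //.
  by rewrite ffunE inordK -ck // ltnS (leq_trans (leq_div _ _)) // -ltnS.
have k_lt : (k j %/ 2 ^ l j).-1 < N.+1.
  by rewrite (leq_ltn_trans (leq_pred _)) // (leq_ltn_trans (leq_div _ _)).
by rewrite kl (eqP (cl j)) ffunE /= inordK // prednK // odd_gt0 // kl.
Qed.

Local Open Scope ring_scope.

(** Each of the $L^d$ scales contributes the sum over one dyadic box, or nothing. *)
Lemma corner_sum_le (R : realDomainType) (I : finType) (P : pred I) (s : I -> R)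
    (c : I -> cell) (k : cell) (K : nat) :
  (forall B, `|\sum_(i | P i) s i *+ in_dbox B (c i)| <= K%:R) ->
  `|\sum_(i | P i) s i *+ [forall j, (c i j < k j)%N]| <= K%:R *+ (L ^ d)%N.
Proof.
move=> boxK.
under eq_bigr do rewrite corner_decomposition -sumrMnr.
rewrite exchange_big (le_trans (ler_norm_sum _ _ _)) //.
rewrite (_ : (L ^ d)%N = #|{: scale}|)%N; last by rewrite card_ffun !card_ord.
rewrite -sumr_const; apply: ler_sum => l _.
case: [forall j, _]; first exact: boxK.
by rewrite big1 ?normr0 // => i _; rewrite mulr0n.
Qed.

End Dyadic.

Local Open Scope classical_set_scope.
Local Open Scope ring_scope.

(** * Maps into a finite type *)

Section FiniteValued.
Context (dT : measure_display) (T : measurableType dT) (F : finType) (f : T -> F).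
Hypothesis mf : forall a, measurable (f @^-1` [set a]).

Lemma measurable_finite_preimage (Y : set F) : measurable (f @^-1` Y).
Proof.
rewrite (_ : _ @^-1` _ = \bigcup_(a in Y) (f @^-1` [set a])); last first.
  by apply/seteqP; split=> [t Yt|t [a + /= fta]]; [exists (f t)|rewrite -fta].
by apply: fin_bigcup_measurable => // ; exact: finite_finset.
Qed.

Lemma measurable_fun_finite dU (U : measurableType dU) (g : F -> U) :
  measurable_fun [set: T] (g \o f).
Proof.
by move=> _ Y _; rewrite setTI comp_preimage; exact: measurable_finite_preimage.
Qed.

Lemma integral_finite (R : realType) (P : {measure set T -> \bar R}) (g : F -> R) :
  (forall a, 0 <= g a) ->
  (\int[P]_t (g (f t))%:E = \sum_a (g a)%:E * P (f @^-1` [set a]))%E.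
Proof.
move=> g0.
transitivity (\int[P]_t \sum_a ((g a)%:E * (\1_(f @^-1` [set a]) t)%:E))%E.
  apply: eq_integral => t _; rewrite (bigD1 (f t)) //= big1 ?adde0 => [|a aft].
    by rewrite indicE mem_set // mule1.
  by rewrite indicE memNset ?mule0 // => /eqP; rewrite eq_sym (negbTE aft).
rewrite ge0_integral_sum //=.
- apply: eq_bigr => a _; rewrite ge0_integralZl_EFin //.
    by rewrite integral_indic // setIT.
  by apply/measurable_EFinP; exact: measurable_indic.
- move=> a; apply/measurable_EFinP; apply: measurable_funM => //.
- by move=> a t _; rewrite mule_ge0 // lee_fin.
Qed.
End FiniteValued.

(** * Quantile grids of a real random variable *)

(** The infimum of the [t] at which the distribution function reaches [a] works, by one-sided
    continuity on each side. *)
Lemma has_quantile (R : realType) (dT : measure_display) (T : measurableType dT)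
    (P : probability T R) (X : {RV P >-> R}) (a : R) : 0 < a < 1 ->
  exists q : R, (P [set t | X t < q]%R <= a%:E)%E /\ (a%:E <= P [set t | X t <= q]%R)%E.
Proof.
move=> /andP[a0 a1].
have cdfE t : @cdf _ _ _ P X t = P [set w | X w <= t] by [].
(* The left continuity of $t \mapsto P(X < t)$ is obtained as right continuity for [- X]. *)
have ccdfE t : @ccdf _ _ _ P (- X) t = P [set w | X w < - t].
  rewrite /ccdf /distribution /pushforward /=.
  rewrite (_ : _ @^-1` _ = [set w | X w < - t]) //.
  by apply/seteqP; split => w /=; rewrite in_itv andbT /= ltrNr.
pose A := [set t | (a%:E <= @cdf _ _ _ P X t)%E].
have notA t : ~ A t -> (@cdf _ _ _ P X t <= a%:E)%E.
  by move=> /negP; rewrite -ltNge => /ltW.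
have A0 : A !=set0.
  apply/set0P/eqP => A0; have := @cvg_cdfy1 _ _ _ P X.
  have F_le t : (@cdf _ _ _ P X t <= a%:E)%E by apply: notA; rewrite A0.
  by move=> /cvge_to_le/(_ (nearW _ F_le)); rewrite lee_fin leNgt a1.
have Alb : has_lbound A.
  have [t At] : exists t, ~ A t.
    apply/existsNP => AT; have := @cvg_cdfNy0 _ _ _ P X.
    by move=> /cvge_to_ge/(_ (nearW _ AT)); rewrite lee_fin leNgt a0.
  exists t => s As; rewrite leNgt; apply/negP => st; apply: At.
  by rewrite /A /= (le_trans As) // cdf_nondecreasing // ltW.
have [q q_lb q_lt] : exists2 q, lbound A q & forall t, q < t -> exists2 s, A s & s < t.
  by exists (inf A) => [|t]; [exact: ge_inf|exact: inf_lt].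
exists q; split.
  have := @ccdf_right_continuous _ _ _ P (- X) (- q).
  rewrite ccdfE opprK; apply: cvge_le; near=> t.
  rewrite ccdfE (@le_trans _ _ (@cdf _ _ _ P X (- t))) //.
    rewrite cdfE le_measure ?inE //.
    - exact: (measurable_funPTI X (measurable_itv `]-oo, (- t)%R[)).
    - exact: (measurable_funPTI X (measurable_itv `]-oo, (- t)%R])).
    - by move=> w /= /ltW.
  apply: notA => /q_lb; rewrite leNgt => /negP; apply.
  by rewrite ltrNl; near: t; exact: nbhs_right_gt.
rewrite -cdfE; have := @cdf_right_continuous _ _ _ P X q.
apply: cvge_ge; near=> t.
have [|s As st] := q_lt t; first by near: t; exact: nbhs_right_gt.
by rewrite (le_trans As) // cdf_nondecreasing // ltW.
Unshelve. all: by end_near.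
Qed.

Lemma measurable_ffun_fiber (dT : measure_display) (T : measurableType dT)
    (J F : finType) (f : J -> T -> F) :
  (forall j a, measurable (f j @^-1` [set a])) ->
  forall a, measurable ((fun t => [ffun j => f j t]) @^-1` [set a]).
Proof.
move=> mf a.
rewrite (_ : _ @^-1` _ = \bigcap_(j in [set: J]) (f j @^-1` [set a j])).
  by apply: fin_bigcap_measurable => [|j _]; [exact: finite_finset|exact: mf].
apply/seteqP; split=> [t /= <- j _|t /= ta]; first by rewrite /= ffunE.
by apply/ffunP => j; rewrite ffunE; exact: ta.
Qed.

Lemma measurable_bool_fiber (dT : measure_display) (T : measurableType dT)
    (f : T -> bool) : measurable_fun [set: T] f ->
  forall b, measurable (f @^-1` [set b]).
Proof. by move=> mf b; rewrite -[_ @^-1` _]setTI; apply: mf. Qed.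

(** For a nondecreasing grid [q], this recovers each comparison of [q l] with a real from the number
    of grid points below it. *)
Lemma initial_segment (N : nat) (p : pred 'I_N) :
  (forall l l' : 'I_N, (l <= l')%N -> p l' -> p l) ->
  forall l : 'I_N, p l = (l < #|p|)%N.
Proof.
move=> pdown l.
have card_lt (m : nat) : (m <= N)%N -> #|[pred l' : 'I_N | (l' < m)%N]| = m.
  by move=> mN; rewrite -sum1_card (big_ord_narrow mN) sum1_card card_ord.
case: (boolP (p l)) => pl; apply/esym.
  rewrite -(card_lt l.+1) //; apply: subset_leq_card.
  by apply/fintype.subsetP => l'; rewrite !inE ltnS => /pdown; apply.
apply/negbTE; rewrite -leqNgt.
apply: (@leq_trans #|[pred l' : 'I_N | (l' < l)%N]|); last first.
  by rewrite card_lt // ltnW.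
apply: subset_leq_card; apply/fintype.subsetP => l' pl'; rewrite !inE ltnNge.
by apply: contra pl => ll'; apply: (pdown _ _ ll').
Qed.

Section Rank.
Context (R : realType) (N : nat).
Implicit Types (q : 'I_N -> R) (t : R).

(** Points are located by [rank_lt] and box bounds by [rank_le]: a strict inequality between these
    ranks then forces the point below the bound, even when one of them equals a quantile. *)
Definition rank_lt q t := #|[pred l | q l < t]|.
Definition rank_le q t := #|[pred l | q l <= t]|.

Lemma rank_lt_le q t : (rank_lt q t <= rank_le q t)%N.
Proof. by apply: subset_leq_card; apply/fintype.subsetP => l; rewrite !inE => /ltW. Qed.

Lemma rank_le_homo q t t' : t <= t' -> (rank_le q t <= rank_le q t')%N.
Proof.
move=> tt'; apply: subset_leq_card; apply/fintype.subsetP => l; rewrite !inE.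
by move=> /le_trans; apply.
Qed.

Lemma rank_lt_lt q t b : (rank_lt q t < rank_le q b)%N -> t <= b.
Proof.
move=> tb; rewrite leNgt; apply/negP => bt; move: tb; rewrite ltnNge => /negP; apply.
apply: subset_leq_card; apply/fintype.subsetP => l; rewrite !inE.
by move=> /le_lt_trans; apply.
Qed.

Lemma rank_lt_bound q t : (rank_lt q t < N.+1)%N.
Proof. by rewrite ltnS -[leqRHS]card_ord max_card. Qed.

Lemma rank_le_bound q t : (rank_le q t < N.+1)%N.
Proof. by rewrite ltnS -[leqRHS]card_ord max_card. Qed.

(* When q lists the quantiles of a law in increasing order, this is the open gap
   between two consecutive ones; its mass is small even if the law has atoms. *)
Definition strip q (k : nat) : set R :=
  [set t | rank_lt q t = k /\ rank_le q t = k].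

(** The chain [rank_le q b <= rank_lt q t <= rank_le q t <= rank_le q b] collapses to equalities. *)
Lemma notin_corner_strip q t b : t <= b -> (rank_le q b <= rank_lt q t)%N ->
  strip q (rank_le q b) t.
Proof.
move=> tb bt; have tt := rank_lt_le q t; have tb' := rank_le_homo q tb.
by split; lia.
Qed.

Lemma measurable_rank_fiber (dT : measure_display) (T : measurableType dT)
  (X : T -> R) q : measurable_fun [set: T] X ->
  forall a, measurable ((fun w => [ffun l => (q l < X w, q l <= X w)]) @^-1` [set a]).
Proof.
move=> mX; apply: measurable_ffun_fiber => l [a b].
rewrite (_ : _ @^-1` _ = (fun w => q l < X w) @^-1` [set a] `&`
    (fun w => q l <= X w) @^-1` [set b]).
  apply: measurableI; apply: measurable_bool_fiber.
    exact: measurable_fun_ltr.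
  exact: measurable_fun_ler.
by apply/seteqP; split=> [w [<- <-]|w /= [<- <-]].
Qed.

(** Ranks depend on [X w] only through finitely many comparisons, so [Y] may be arbitrary. *)
Lemma measurable_ranks (dT : measure_display) (T : measurableType dT)
    (X : T -> R) q (Y : nat -> nat -> Prop) : measurable_fun [set: T] X ->
  measurable [set w | Y (rank_lt q (X w)) (rank_le q (X w))].
Proof.
move=> mX; pose ranks (g : {ffun 'I_N -> bool * bool}) :=
  Y #|[pred l | (g l).1]| #|[pred l | (g l).2]|.
suff -> : [set w | Y (rank_lt q (X w)) (rank_le q (X w))] =
    (fun w => [ffun l => (q l < X w, q l <= X w)]) @^-1` [set g | ranks g].
  exact: (measurable_finite_preimage (measurable_rank_fiber q mX)).
apply: eq_set => w; rewrite /ranks /rank_lt /rank_le.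
by congr (Y _ _); apply: eq_card => l; rewrite !inE ffunE.
Qed.
End Rank.

(** With [q l] a quantile of order $(l+1)/(N+1)$, strip [k] lies strictly between [q (k-1)] and
    [q k]. At least $k/(N+1)$ of the mass is at or below the former and at most $(k+1)/(N+1)$
    strictly below the latter. *)
Lemma has_quantile_grid (R : realType) (dT : measure_display)
    (T : measurableType dT) (P : probability T R) (X : {RV P >-> R}) (N : nat) :
  exists q : 'I_N -> R,
    forall k, (P (X @^-1` strip q k) <= (N.+1%:R^-1)%:E)%E.
Proof.
have /choice[q qP] : forall l : 'I_N, exists q : R,
    (P [set t | X t < q]%R <= (l.+1%:R / N.+1%:R)%:E)%E /\
    ((l.+1%:R / N.+1%:R)%:E <= P [set t | X t <= q]%R)%E.
  move=> l; apply: has_quantile.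
  by rewrite divr_gt0 //= ltr_pdivrMr // mul1r ltr_nat ltnS.
have mlt t : measurable [set w | X w < t].
  exact: (measurable_funPTI X (measurable_itv `]-oo, t[)).
have mle t : measurable [set w | X w <= t].
  exact: (measurable_funPTI X (measurable_itv `]-oo, t])).
(* Separately chosen quantiles are ordered all the same: an inversion would put the larger order
   below the smaller one. *)
have q_mono (l l' : 'I_N) : (l <= l')%N -> q l <= q l'.
  rewrite leq_eqVlt => /predU1P[/val_inj -> //|ll']; rewrite leNgt; apply/negP => qll'.
  have [Pl _] := qP l; have [_ Pl'] := qP l'.
  have Ple : (P [set w | X w <= q l']%R <= P [set w | X w < q l]%R)%E.
    by apply: le_measure; rewrite ?inE //= => w /= /le_lt_trans; apply.
  have := le_trans Pl' (le_trans Ple Pl).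
  by rewrite lee_fin ler_pM2r ?invr_gt0 // ler_nat ltnS leqNgt ll'.
have rank_ltE (l : 'I_N) t : (q l < t) = (l < rank_lt q t)%N.
  apply: (@initial_segment _ [pred l | q l < t]) => l1 l2 /q_mono q12 /=.
  exact: le_lt_trans.
have rank_leE (l : 'I_N) t : (q l <= t) = (l < rank_le q t)%N.
  apply: (@initial_segment _ [pred l | q l <= t]) => l1 l2 /q_mono q12 /=.
  exact: le_trans.
exists q => k; set S := _ @^-1` _.
have mS : measurable S.
  exact: (@measurable_ranks _ _ _ _ _ q (fun a b => a = k /\ b = k) (measurable_funPT X)).
have [->|/set0P[w0 w0S]] := eqVneq S set0; first by rewrite measure0 lee_fin.
have kN : (k <= N)%N by case: w0S => <- _; rewrite -ltnS rank_lt_bound.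
(* [V] is the part left of the strip, empty when [k] is 0. The sample [w0] of the strip serves to
   compare [V] with [U] below. *)
have [V [mV SV ltV PV]] : exists V, [/\ measurable V, S `&` V = set0,
    forall w, V w -> X w < X w0 & ((k%:R / N.+1%:R)%:E <= P V)%E].
  have [k0|k_gt0] := posnP k.
    exists set0; split=> //; first by rewrite setI0.
    by rewrite k0 mul0r measure0.
  have kN' : (k.-1 < N)%N by rewrite prednK.
  have qX w : S w -> q (Ordinal kN') < X w.
    by case=> wk _; rewrite rank_ltE wk /= prednK.
  exists [set w | X w <= q (Ordinal kN')]; split=> //.
  - apply/seteqP; split=> // w [/qX qw] /=.
    by rewrite leNgt qw.
  - by move=> w /= /le_lt_trans; apply; exact: qX.
  - by have [_] := qP (Ordinal kN'); rewrite /= prednK.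
(* [U] is everything left of the next quantile, or the whole space for the last strip. *)
have [U [mU SU ltU PU]] : exists U, [/\ measurable U, S `<=` U,
    forall w, X w <= X w0 -> U w & (P U <= (k.+1%:R / N.+1%:R)%:E)%E].
  move: kN; rewrite leq_eqVlt => /predU1P[kN|kN].
    exists setT; split=> //; rewrite kN divff ?pnatr_eq0 //.
    exact: probability_le1.
  have Xq w : S w -> X w < q (Ordinal kN).
    by case=> _ wk; rewrite ltNge rank_leE wk ltnn.
  exists [set w | X w < q (Ordinal kN)]; split=> //; last by have [] := qP (Ordinal kN).
  by move=> w /= /le_lt_trans; apply; exact: Xq.
have : (P S + P V <= P U)%E.
  rewrite -measureU //; apply: le_measure; rewrite ?inE //; first exact: measurableU.
  by rewrite subUset; split=> // w /ltV/ltW; exact: ltU.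
move=> /le_trans/(_ PU); rewrite -leeBrDr ?fin_num_measure // => /le_trans; apply.
apply: (le_trans (leeB (lexx _) PV)).
by rewrite -EFinB lee_fin -mulrBl -natrB // subSnn mul1r.
Qed.

(** * Exponential moment of the number of points in a set *)

Section ExponentialMoment.
Context (R : realType) (dO dT : measure_display) (Omega : measurableType dO)
  (T : measurableType dT) (P : probability Omega R) (m : nat).
Variables (X : 'I_m -> Omega -> T) (S : set T) (p : R).
Hypothesis mX : forall i, measurable_fun [set: Omega] (X i).
Hypothesis indX : mutually_independent P X.
Hypothesis mS : measurable S.
Hypothesis SP : forall i, (P (X i @^-1` S) <= p%:E)%E.

Let hits w : {ffun 'I_m -> bool} := [ffun i => X i w \in S].

Let mXS i : measurable (X i @^-1` S).
Proof. by rewrite -[_ @^-1` _]setTI; exact: mX. Qed.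

Let mhits a : measurable (hits @^-1` [set a]).
Proof.
apply: measurable_ffun_fiber => i b.
case: b.
  rewrite (_ : _ @^-1` _ = X i @^-1` S) //.
  by apply/seteqP; split => w /=; [move=> /set_mem|move=> /mem_set].
rewrite (_ : _ @^-1` _ = ~` (X i @^-1` S)); first exact: measurableC.
by apply/seteqP; split => w /=; [move/negbT; rewrite notin_setE|exact: memNset].
Qed.

Let pr i : R := fine (P (X i @^-1` S)).

Let prE i : P (X i @^-1` S) = (pr i)%:E.
Proof. by rewrite /pr fineK // fin_num_measure. Qed.

Let P_hits (a : {ffun 'I_m -> bool}) :
  P (hits @^-1` [set a]) = (\prod_i (if a i then pr i else 1 - pr i))%:E.
Proof.
pose A i := if a i then S else ~` S.
have -> : hits @^-1` [set a] = \bigcap_(i in [set: 'I_m]) (X i @^-1` A i).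
  apply/seteqP; split=> [w /= wa i _|w wA].
    rewrite /A -wa ffunE /=; case: ifPn => [/set_mem|] //.
    by rewrite notin_setE.
  apply/ffunP => i; rewrite ffunE; have := wA i I; rewrite /A /=.
  by case: (a i); [exact: mem_set|exact: memNset].
rewrite indX; last by move=> i; rewrite /A; case: ifP => // _; exact: measurableC.
rewrite -prodEFin; apply: eq_bigr => i _; rewrite /A; case: ifP => _; first exact: prE.
by rewrite -preimage_setC probability_setC // prE.
Qed.

(** The count is a sum of independent Bernoulli variables, and each contributes a factor $1 +
    p_i(e-1) \le e^{p(e-1)}$. *)
Lemma exponential_moment_le :
  (\int[P]_w (expR (\sum_i \1_S (X i w)))%:E
     <= (expR (m%:R * p * (expR 1 - 1)))%:E)%E.
Proof.
pose g (a : {ffun 'I_m -> bool}) : R := \prod_i (if a i then expR 1 else 1).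
under eq_integral => w _.
  rewrite (_ : expR _ = g (hits w)); last first.
    rewrite expR_sum; apply: eq_bigr => i _.
    by rewrite ffunE indicE; case: (_ \in _); rewrite // expR0.
  over.
rewrite (integral_finite mhits); last first.
  by move=> a; apply: prodr_ge0 => i _; case: ifP => // _; exact: expR_ge0.
rewrite (eq_bigr (fun a : {ffun 'I_m -> bool} =>
    (\prod_i (if a i then expR 1 * pr i else 1 - pr i))%:E)) => [|a _]; last first.
  rewrite [X in (_ * X)%E]P_hits -EFinM -big_split /=; congr (_%:E).
  by apply: eq_bigr => i _; case: ifP; rewrite ?mul1r.
rewrite sumEFin lee_fin.
(* The sum over all hit patterns factors into one two-term sum per point. *)
rewrite -(bigA_distr_bigA (fun i b => if b then expR 1 * pr i else 1 - pr i)) /=.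
apply: (@le_trans _ _ (\prod_(i < m) expR (p * (expR 1 - 1)))); last first.
  by rewrite prodr_const card_ord -expRM_natl mulrA.
apply: ler_prod => i _; rewrite big_bool /=.
have pr0 : 0 <= pr i by rewrite fine_ge0.
have prp : pr i <= p by rewrite -lee_fin -prE.
have pr1 : pr i <= 1 by rewrite -lee_fin -prE probability_le1.
apply/andP; split; first by rewrite addr_ge0 ?subr_ge0 // mulr_ge0 ?expR_ge0.
rewrite (_ : _ + _ = 1 + pr i * (expR 1 - 1)); last by rewrite mulrBr mulr1 addrCA mulrC.
by rewrite (le_trans (expR_ge1Dx _)) // ler_expR ler_wpM2r.
Qed.
End ExponentialMoment.

(** * Auxiliary measurability and integration *)

Lemma measurable_pair_fiber (dT : measure_display) (T : measurableType dT)
    (F G : finType) (f : T -> F) (g : T -> G) :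
  (forall a, measurable (f @^-1` [set a])) ->
  (forall b, measurable (g @^-1` [set b])) ->
  forall c, measurable ((fun t => (f t, g t)) @^-1` [set c]).
Proof.
move=> mf mg [a b].
rewrite (_ : _ @^-1` _ = f @^-1` [set a] `&` g @^-1` [set b]); first exact: measurableI.
by apply/seteqP; split=> [t [<- <-]|t /= [<- <-]].
Qed.

Lemma measurable_comp_fiber (dT dU : measure_display) (T : measurableType dT)
    (U : measurableType dU) (F : Type) (f : T -> U) (g : U -> F) :
  measurable_fun [set: T] f -> (forall a, measurable (g @^-1` [set a])) ->
  forall a, measurable ((g \o f) @^-1` [set a]).
Proof. by move=> mf mg a; rewrite comp_preimage -[_ @^-1` _]setTI; apply: mf. Qed.

(** The integral of a nonnegative function is a supremum over the simple functions below it, hence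
    monotone. This bounds the integral of the supremum over boxes without a proof of its
    measurability. *)
Lemma ge0_le_integral_nonmeasurable (dT : measure_display) (T : measurableType dT)
    (R : realType) (mu : {measure set T -> \bar R}) (f g : T -> \bar R) :
  (forall t, 0 <= f t)%E -> (forall t, f t <= g t)%E ->
  (\int[mu]_t f t <= \int[mu]_t g t)%E.
Proof.
move=> f0 fg; rewrite !ge0_integralTE // => [|t]; last exact: le_trans (fg t).
apply: le_ereal_sup => _ [h hf <-]; exists h => // t.
exact: le_trans (fg t).
Qed.

(** Used for the deterministic algorithm, whose internal randomness is a Dirac mass. *)
Lemma integral_prod_dirac (dT dU : measure_display) (T : measurableType dT)
    (U : measurableType dU) (R : realType) (P : probability T R) (u : U)
    (f : T -> \bar R) : measurable_fun [set: T] f -> (forall t, 0 <= f t)%E ->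
  (\int[P \x (\d_u : probability U R)]_z f z.1 = \int[P]_t f t)%E.
Proof.
move=> mf f0.
rewrite fubini_tonelli1 //=; last exact: measurableT_comp.
rewrite /fubini_F; apply: eq_integral => t _ /=.
by rewrite integral_dirac // diracT mul1e.
Qed.

(** * The counter chain as an online algorithm *)

Section ThinningAlgorithm.
Context (R : realType) (d : nat) (I X : finType) (inc : I -> pred X) (K : nat).
Variable cell : borelRV R d -> X.
Hypothesis mcell : forall a, measurable (cell @^-1` [set a]).

(* Signs other than 1 and -1, a null event, get the code [None], which is never
   retained: the discrepancy bound thus holds surely and not only almost surely. *)
Definition code (p : signed_point R d) : option (bool * X) :=
  if p.2 == 1 then Some (true, cell p.1)
  else if p.2 == -1 then Some (false, cell p.1) else None.

Lemma measurable_code a : measurable (code @^-1` [set a]).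
Proof.
pose f (p : signed_point R d) := (p.2 == 1, p.2 == -1, cell p.1).
pose g (t : bool * bool * X) :=
  if t.1.1 then Some (true, t.2) else if t.1.2 then Some (false, t.2) else None.
have -> : code = g \o f by [].
rewrite comp_preimage; apply: measurable_finite_preimage => {}a.
have meq (c : R) b : measurable ((fun p : signed_point R d => p.2 == c) @^-1` [set b]).
  by apply: measurable_bool_fiber; apply: measurable_fun_eqr.
apply: measurable_pair_fiber; first by apply: measurable_pair_fiber.
by apply: (measurable_comp_fiber (f := fst)).
Qed.

Variable w0 : {ffun I -> 'I_K.+1}.

(** The counters are not stored: they are recomputed by replaying the retained history from [w0]. *)
Definition thin (_ : nat) (_ : unit) (h : seq (signed_point R d))
    (p : signed_point R d) : bool :=
  fits inc (foldl (step inc) w0 [seq code q | q <- h]) (code p).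

Lemma measurable_thin i k :
  measurable_fun [set: unit * k.-tuple (signed_point R d) * signed_point R d]
    (fun z => thin i z.1.1 z.1.2 z.2).
Proof.
pose f (z : unit * k.-tuple (signed_point R d) * signed_point R d) :=
  ([ffun j => code (tnth z.1.2 j)], code z.2).
pose g (c : {ffun 'I_k -> option (bool * X)} * option (bool * X)) :=
  fits inc (foldl (step inc) w0 [seq c.1 j | j <- enum 'I_k]) c.2.
rewrite (_ : (fun z => _) = g \o f); last first.
  apply/funext => z; rewrite /thin /g /=; congr (fits _ (foldl _ _ _) _).
  rewrite -{1}(map_tnth_enum z.1.2) -map_comp.
  by apply: eq_map => j; rewrite /= ffunE.
apply: measurable_fun_finite; apply: measurable_pair_fiber.
  apply: measurable_ffun_fiber => j.
  apply: (@measurable_comp_fiber _ _ _ _ _ (fun z => tnth z.1.2 j) code).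
    apply: (@measurableT_comp _ _ _ _ _ _ (@tnth k _ ^~ j)).
      exact: measurable_tnth.
    exact: measurableT_comp.
  exact: measurable_code.
by apply: (@measurable_comp_fiber _ _ _ _ _ snd code) => //; exact: measurable_code.
Qed.

Definition thinning : online_algorithm R d :=
  @OnlineAlgorithm R d _ unit (\d_tt : probability unit R) thin measurable_thin.

(** A discarded point does not move the counters, so replaying the retained points alone gives the
    true state. *)
Lemma decisions_thinning (u : rand_space thinning) i (h s : seq (signed_point R d)) :
  decisions_from u i h s =
  run inc (foldl (step inc) w0 [seq code q | q <- h]) [seq code q | q <- s].
Proof.
elim: s i h => //= p s IHs i h; congr (_ :: _); rewrite IHs.
case: (boolP (thin _ _ _ _)) => [|/step_stuck ->] //.
by rewrite map_rcons -cats1 foldl_cat.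
Qed.

Section Stream.
Variables (m : nat) (u : rand_space thinning) (p : 'I_m -> signed_point R d).
Let codes := [seq code (p j) | j <- enum 'I_m].

Let size_codes : size codes = m. Proof. by rewrite size_map size_enum_ord. Qed.

Lemma retainedE (i : 'I_m) : retained u p i = nth false (run inc w0 codes) i.
Proof. by rewrite /retained decisions_thinning -map_comp. Qed.

Lemma discarded_countE : discarded_count u p = count negb (run inc w0 codes).
Proof.
rewrite /discarded_count -sum1_card.
rewrite (eq_bigl (fun i : 'I_m => ~~ nth false (run inc w0 codes) i)); last first.
  by move=> i; rewrite inE retainedE.
rewrite -sum1_count (big_nth false) size_run size_codes big_mkord.
by apply: eq_bigl.
Qed.

Lemma sign_sum_le (i : I) (k : nat) :
  `|\sum_(j < m | (j < k)%N && retained u p j) (p j).2 *+ inc i (cell (p j).1)| <= K%:R.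
Proof.
apply: le_trans (balance_le inc R w0 codes k i).
rewrite size_codes big_mkord.
under eq_bigl do rewrite retainedE.
rewrite le_eqVlt; apply/orP; left; apply/eqP; congr `|_|.
(* A retained point has a code other than [None], so its sign is 1 or -1 and equals its jump. *)
apply: eq_bigr => j /andP[_ /run_signed].
have codeE : nth None codes j = code (p j).
  by rewrite (nth_map j) ?size_enum_ord // nth_ord_enum.
rewrite codeE /code; case: eqP => [-> //|_].
by case: eqP => [->|].
Qed.

Lemma retained_sign (j : 'I_m) : retained u p j -> `|(p j).2| = 1.
Proof.
rewrite retainedE => /run_signed.
rewrite (nth_map j) ?size_enum_ord // nth_ord_enum /code.
by case: eqP => [->|_]; [rewrite normr1|case: eqP => [->|//]; rewrite normrN1].
Qed.
End Stream.
End ThinningAlgorithm.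

(** * Expected number of discards *)

Section ExpectedDiscards.
Context (R : realType) (d : nat) (I X : finType) (inc : I -> pred X) (K : nat).
Variable cell : borelRV R d -> X.
Hypothesis mcell : forall a, measurable (cell @^-1` [set a]).
Variable r : nat.
Hypothesis inc_card : forall x, (#|[pred i | inc i x]| <= r)%N.
Context (dO : measure_display) (Omega : measurableType dO) (P : probability Omega R)
  (m : nat) (x : 'I_m -> {RV P >-> borelRV R d}) (eps : 'I_m -> {RV P >-> R}).
Hypothesis eps_indep : mutually_independent P (fun i => eps i : Omega -> R).
Hypothesis eps_rad : forall i, rademacher (eps i).
Hypothesis x_eps_indep :
  independent P (fun o => [tuple x i o | i < m]) (fun o => [tuple eps i o | i < m]).

(** Every value other than 1 is read as negative here; the discrepancy with [code] is a null
    event. *)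
Let signs o : m.-tuple bool := [tuple eps i o == 1 | i < m].
Let cells o : m.-tuple X := [tuple cell (x i o) | i < m].

Let sign_set (b : bool) : set R := [set y | (y == 1) = b].
Let sign_event (e : m.-tuple bool) : set (m.-tuple R) :=
  [set t | forall i, sign_set (tnth e i) (tnth t i)].
Let cell_event (c : m.-tuple X) : set (m.-tuple (borelRV R d)) :=
  [set t | forall i, cell (tnth t i) = tnth c i].

Let measurable_sign_set b : measurable (sign_set b).
Proof.
by apply: (measurable_bool_fiber (f := fun y : R => y == 1)); exact: measurable_fun_eqr.
Qed.

Let measurable_sign_event e : measurable (sign_event e).
Proof.
rewrite (_ : sign_event e =
  \bigcap_(i in [set: 'I_m]) ((@tnth m R)^~ i @^-1` sign_set (tnth e i))).
  apply: fin_bigcap_measurable => [|i _]; first exact: finite_finset.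
  by rewrite -[_ @^-1` _]setTI; exact: measurable_tnth.
by apply/seteqP; split=> [t te i _|t te i]; [exact: te|exact: te].
Qed.

Let measurable_cell_event c : measurable (cell_event c).
Proof.
rewrite (_ : cell_event c =
  \bigcap_(i in [set: 'I_m]) ((@tnth m _)^~ i @^-1` (cell @^-1` [set tnth c i]))).
  apply: fin_bigcap_measurable => [|i _]; first exact: finite_finset.
  by rewrite -[_ @^-1` _]setTI; exact: measurable_tnth.
by apply/seteqP; split=> [t te i _|t te i]; [exact: te|exact: te].
Qed.

Let P_sign i b : P (eps i @^-1` sign_set b) = (2^-1)%:E.
Proof.
have [P1 _] := eps_rad i.
have E1 : sign_set true = [set 1] by apply/seteqP; split=> y /eqP.
case: b; first by rewrite E1.
have -> : sign_set false = ~` [set 1].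
  by apply/seteqP; split=> y /=; [move=> /negbT/eqP|move=> /eqP/negbTE].
have mE : measurable (eps i @^-1` [set 1]).
  by rewrite -E1; exact: (measurable_funPTI (eps i) (measurable_sign_set true)).
rewrite -preimage_setC probability_setC //.
by rewrite P1 -EFinB; congr (_%:E); rewrite [X in X - _](splitr 1) mul1r addrK.
Qed.

Let P_signs e :
  P ((fun o => [tuple eps i o | i < m]) @^-1` sign_event e) = (2^-1 ^+ m)%:E.
Proof.
have -> : (fun o => [tuple eps i o | i < m]) @^-1` sign_event e =
    \bigcap_(i in [set: 'I_m]) (eps i @^-1` sign_set (tnth e i)).
  apply/seteqP; split=> [w oe i _|w oe i] /=.
    by have := oe i; rewrite tnth_mktuple.
  by rewrite tnth_mktuple; exact: oe.
rewrite eps_indep // (eq_bigr (fun=> (2^-1)%:E)) => [|i _]; last exact: P_sign.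
by rewrite prodEFin prodr_const card_ord.
Qed.

Let cell_prob c : R := fine (P ((fun o => [tuple x i o | i < m]) @^-1` cell_event c)).

Let measurable_x : measurable_fun [set: Omega] (fun o => [tuple x i o | i < m]).
Proof.
apply/measurable_fun_tnthP => i.
by apply: (eq_measurable_fun (x i)) => // o _; rewrite /= tnth_mktuple.
Qed.

Let measurable_eps : measurable_fun [set: Omega] (fun o => [tuple eps i o | i < m]).
Proof.
apply/measurable_fun_tnthP => i.
by apply: (eq_measurable_fun (eps i)) => // o _; rewrite /= tnth_mktuple.
Qed.

Let mcell_event c : measurable ((fun o => [tuple x i o | i < m]) @^-1` cell_event c).
Proof. by rewrite -[_ @^-1` _]setTI; exact: measurable_x. Qed.

Let cellsE c : (fun o => [tuple x i o | i < m]) @^-1` cell_event c = cells @^-1` [set c].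
Proof.
apply/seteqP; split=> o /=.
  by move=> oc; apply: eq_from_tnth => i; rewrite -oc !tnth_mktuple.
by move=> <- i; rewrite !tnth_mktuple.
Qed.

Let signsE e :
  (fun o => [tuple eps i o | i < m]) @^-1` sign_event e = signs @^-1` [set e].
Proof.
apply/seteqP; split=> o /=.
  by move=> oc; apply: eq_from_tnth => i; rewrite -oc !tnth_mktuple.
by move=> <- i; rewrite /sign_set /= !tnth_mktuple.
Qed.

Let fiberE e c : (fun o => (signs o, cells o)) @^-1` [set (e, c)] =
  (fun o => [tuple x i o | i < m]) @^-1` cell_event c `&`
  (fun o => [tuple eps i o | i < m]) @^-1` sign_event e.
Proof.
rewrite cellsE signsE.
by apply/seteqP; split=> [w [<- <-]|w /= [<- <-]].
Qed.

Let mfiber a : measurable ((fun o => (signs o, cells o)) @^-1` [set a]).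
Proof.
case: a => e c; rewrite fiberE; apply: measurableI => //.
by rewrite -[_ @^-1` _]setTI; exact: measurable_eps.
Qed.

(** The signs are uniform on the cube and independent of the points, so the joint weight factors. *)
Let P_fiber e c : P ((fun o => (signs o, cells o)) @^-1` [set (e, c)]) =
  (2^-1 ^+ m * cell_prob c)%:E.
Proof.
rewrite fiberE x_eps_indep // P_signs muleC EFinM.
by rewrite /cell_prob fineK // fin_num_measure.
Qed.

Let cell_prob_sum : \sum_c cell_prob c = 1.
Proof.
apply: EFin_inj; rewrite -sumEFin -(probability_setT P).
rewrite -[in RHS](_ : \int[P]_o (cst 1%:E o) = P setT)%E; last first.
  by rewrite integral_cst // mul1e.
have mc a : measurable (cells @^-1` [set a]) by rewrite -cellsE.
have -> := @integral_finite _ _ _ cells mc _ P (fun=> 1) (fun=> ler01).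
by apply: eq_bigr => c _; rewrite mul1e /cell_prob fineK ?fin_num_measure // cellsE.
Qed.

Let discards W (e : m.-tuple bool) (c : m.-tuple X) : nat :=
  count negb (run inc (W : {ffun I -> 'I_K.+1}) [seq Some z | z <- zip e c]).

Let count_codes W o : nat :=
  count negb (run inc (W : {ffun I -> 'I_K.+1})
    [seq code cell (x i o, eps i o) | i <- enum 'I_m]).

Let measurable_count W :
  measurable_fun [set: Omega] (fun o => (count_codes W o)%:R%:E : \bar R).
Proof.
pose f o : {ffun 'I_m -> option (bool * X)} := [ffun i => code cell (x i o, eps i o)].
pose g (c : {ffun 'I_m -> option (bool * X)}) : \bar R :=
  (count negb (run inc W [seq c i | i <- enum 'I_m]))%:R%:E.
rewrite (_ : (fun o => _) = g \o f); last first.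
  apply/funext => o; rewrite /g /f /count_codes /=; do 3 congr (_ _).
  by congr run; apply: eq_map => i; rewrite ffunE.
apply: measurable_fun_finite; apply: measurable_ffun_fiber => i.
apply: (@measurable_comp_fiber _ _ _ _ _ (fun o => (x i o, eps i o)) (code cell)).
  exact: measurable_fun_pair.
exact: measurable_code.
Qed.

Lemma measurable_discarded_count (W : {ffun I -> 'I_K.+1}) : measurable_fun [set: Omega]
  (fun o => (discarded_count (tt : rand_space (thinning inc mcell W))
      (fun i => (x i o, eps i o)))%:R%:E : \bar R).
Proof.
by apply: eq_measurable_fun (measurable_count W) => o _; rewrite discarded_countE.
Qed.

(** Almost surely all signs are 1 or -1, and then the codes are exactly the pairs (sign, cell). *)
Let expected_count W : (\int[P]_o (count_codes W o)%:R%:E =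
  (\sum_e \sum_c (discards W e c)%:R * (2^-1 ^+ m * cell_prob c))%:E)%E.
Proof.
transitivity (\int[P]_o (discards W (signs o) (cells o))%:R%:E)%E.
  apply: ae_eq_integral => //.
    pose g a : \bar R := (discards W a.1 a.2)%:R%:E.
    by apply: (measurable_fun_finite (f := fun o => (signs o, cells o)) _ g).
  have : {ae P, forall o, forall i, eps i o = 1 \/ eps i o = -1}.
    apply: filter_forall => i.
    have m1 (c : R) : measurable (eps i @^-1` [set c]) by exact: measurable_funPTI.
    have mU := measurableU _ _ (m1 1) (m1 (-1)).
    exists (~` (eps i @^-1` [set 1] `|` eps i @^-1` [set -1])); split=> //.
    - exact: measurableC.
    - have [P1 PN1] := eps_rad i.
      rewrite probability_setC // measureU //; last first.
        apply/seteqP; split=> // o [/= -> /eqP].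
        by rewrite eq_sym eqNr oner_eq0.
      rewrite [X in (_ - (X + _))%E]P1 [X in (_ - (_ + X))%E]PN1.
      by rewrite -EFinD -div1r -splitr subrr.
  apply: filterS => o eps_o _; rewrite /count_codes /discards; do 4 congr (_ _).
  rewrite /signs /cells /=; elim: (enum 'I_m) => //= i s <-; congr (_ :: _).
  rewrite /code /=; case: (eps_o i) => ->; first by rewrite eqxx.
  by rewrite eqxx eqNr oner_eq0.
rewrite (@integral_finite _ _ _ (fun o => (signs o, cells o)) mfiber _ P
  (fun a => (discards W a.1 a.2)%:R)) // pair_big -sumEFin.
by apply: eq_bigr => -[e c] _; rewrite [X in (_ * X)%E]P_fiber -EFinM.
Qed.

(** Some state does no worse than the average over all states, which [sum_discards_tuple] bounds for
    each fixed sequence of cells. *)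
Lemma exists_initial_state : exists W : {ffun I -> 'I_K.+1},
  (\int[P]_o (discarded_count (tt : rand_space (thinning inc mcell W))
      (fun i => (x i o, eps i o)))%:R%:E <= ((m * r)%:R / K.+1%:R)%:E)%E.
Proof.
pose ex W : R := \sum_e \sum_c (discards W e c)%:R * (2^-1 ^+ m * cell_prob c).
suff [W exW] : exists W, ex W <= (m * r)%:R / K.+1%:R.
  exists W; under eq_integral do rewrite discarded_countE.
  by rewrite expected_count lee_fin.
apply: contrapT => /forallNP exW.
have : \sum_(W : {ffun I -> 'I_K.+1}) ((m * r)%:R / K.+1%:R) < \sum_W ex W.
  apply: ltr_sum => [|W _]; last by rewrite ltNge; apply/negP.
  by apply/hasP; exists [ffun=> ord0]; rewrite // mem_index_enum.
apply/negP; rewrite -leNgt.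
rewrite (_ : \sum_W ex W = \sum_c (2^-1 ^+ m * cell_prob c) *
    (\sum_W \sum_e discards W e c)%:R); last first.
  under [RHS]eq_bigr do rewrite natr_sum mulr_sumr.
  rewrite [RHS]exchange_big; apply: eq_bigr => W _.
  under [RHS]eq_bigr do rewrite natr_sum mulr_sumr.
  rewrite [RHS]exchange_big; apply: eq_bigr => e _.
  by apply: eq_bigr => c _; rewrite mulrC.
apply: (@le_trans _ _ (\sum_c (2^-1 ^+ m * cell_prob c) *
   ((m * r * #|{: {ffun I -> 'I_K.+1}}| * 2 ^ m)%:R / K.+1%:R))).
  apply: ler_sum => c _; rewrite ler_wpM2l //.
    by rewrite mulr_ge0 ?exprn_ge0 ?fine_ge0.
  rewrite ler_pdivlMr // mulrC -natrM ler_nat.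
  exact: sum_discards_tuple.
rewrite -mulr_suml -mulr_sumr cell_prob_sum mulr1 sumr_const -[leRHS]mulr_natr.
rewrite le_eqVlt; apply/orP; left; apply/eqP.
rewrite !natrM natrX exprVn (_ : #|_| = #|{: {ffun I -> 'I_K.+1}}|) //.
have : (2 ^+ m : R) != 0 by rewrite expf_neq0 ?pnatr_eq0.
have : (K.+1%:R : R) != 0 by rewrite pnatr_eq0.
by move: (2 ^+ m) K.+1%:R => t k t0 k0; field; rewrite t0 k0.
Qed.
End ExpectedDiscards.

(** * Boxes, corners of cells and slabs *)

Definition coordinate (R : realType) (d : nat) (j : 'I_d) (y : borelRV R d) : R :=
  (y : 'rV[R]_d) ord0 j.

Lemma measurable_coordinate (R : realType) (d : nat) (j : 'I_d) :
  measurable_fun [set: borelRV R d] (coordinate j).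
Proof.
apply: (measurability _ (RGenOpens.measurableE R)) => _ [_ [a [b ->] <-]].
rewrite setTI; apply: sub_sigma_algebra.
have /continuousP := @coord_continuous R 1 d ord0 j; apply; exact: interval_open.
Qed.

HB.instance Definition _ (R : realType) (d : nat) (j : 'I_d) :=
  @isMeasurableFun.Build _ _ _ _ (@coordinate R d j) (@measurable_coordinate R d j).

Section Grid.
Context (R : realType) (d L N : nat) (q : 'I_d -> 'I_N -> R).
Hypothesis N2 : N.+1 = (2 ^ L)%N.

Definition cell (y : borelRV R d) : {ffun 'I_d -> 'I_N.+1} :=
  [ffun j => Ordinal (rank_lt_bound (q j) (coordinate j y))].

Definition box_cell (b : 'rV[R]_d) : {ffun 'I_d -> 'I_N.+1} :=
  [ffun j => Ordinal (rank_le_bound (q j) (b ord0 j))].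

Definition slab (j : 'I_d) (k : nat) : set (borelRV R d) :=
  coordinate j @^-1` strip (q j) k.

Lemma measurable_cell a : measurable (cell @^-1` [set a]).
Proof.
apply: measurable_ffun_fiber => j k.
rewrite (_ : _ @^-1` _ = [set y | rank_lt (q j) (coordinate j y) = k]).
  exact: (measurable_ranks (q j) (fun a _ => a = k) (@measurable_coordinate R d j)).
apply/seteqP; split => y /=; first by move=> <-.
by move=> yk; apply: val_inj.
Qed.

Lemma measurable_slab j k : measurable (slab j k).
Proof.
exact: (measurable_ranks (q j) (fun a b => a = k /\ b = k)
  (@measurable_coordinate R d j)).
Qed.

Lemma box_cell_sub b y : [forall j, (cell y j < box_cell b j)%N] -> box b y.
Proof.
move=> /forallP yb j; have := yb j; rewrite !ffunE /= => /rank_lt_lt.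
by rewrite in_itv.
Qed.

Lemma box_sub b y : box b y ->
  ~~ [forall j, (cell y j < box_cell b j)%N] ->
  exists j, slab j (box_cell b j) y.
Proof.
move=> yb; rewrite negb_forall => /existsP[j]; rewrite -leqNgt !ffunE /= => yj.
exists j; rewrite /slab /= ffunE /=; apply: notin_corner_strip => //.
by have := yb j; rewrite in_itv.
Qed.

(** The corner is contained in the box, and any other point of the box lies in a slab along some
    axis. *)
Lemma box_indic_dist b y :
  `|\1_(box b) y - [forall j, (cell y j < box_cell b j)%N]%:R|
    <= \sum_j \1_(slab j (box_cell b j)) y :> R.
Proof.
have slabs0 : 0 <= \sum_j \1_(slab j (box_cell b j)) y :> R by apply: sumr_ge0.
case: (boolP [forall j, _]) => [/box_cell_sub yb|nyb].
  by rewrite indicE mem_set // subrr normr0.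
rewrite indicE; case: (boolP (y \in box b)) => [/set_mem yb|]; last first.
  by rewrite subrr normr0.
have [j yj] := box_sub yb nyb.
by rewrite subr0 normr1 (bigD1 j) //= indicE mem_set // lerDl sumr_ge0.
Qed.

(** The box indicator is the corner indicator plus an error: the counters control the former, the
    number of points in the slabs the latter. *)
Lemma disc_le (K m : nat) (W : {ffun _ -> 'I_K.+1})
    (u : rand_space (thinning (@in_dbox d L N) measurable_cell W))
    (p : 'I_m -> signed_point R d) (k : nat) (b : 'rV[R]_d) :
  disc u p k (box b) <=
    K%:R *+ (L ^ d)%N + \sum_j \sum_(i < m) \1_(slab j (box_cell b j)) (p i).1.
Proof.
rewrite /disc.
pose c i := [forall j, (cell (p i).1 j < box_cell b j)%N].
rewrite (eq_bigr (fun i => (p i).2 *+ c i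
    + (p i).2 * (\1_(box b) (p i).1 - (c i)%:R))); last first.
  by move=> i _; rewrite mulrBr [_ * (c i)%:R]mulr_natr addrC subrK.
rewrite big_split /= (le_trans (ler_normD _ _)) // lerD //.
  by apply: corner_sum_le => // B; exact: sign_sum_le.
rewrite (le_trans (ler_norm_sum _ _ _)) // exchange_big /=.
(* Counting discarded and later points too only enlarges the bound, and frees it from [k] and the
   algorithm. *)
rewrite [leRHS](bigID (fun i : 'I_m => (i < k)%N && retained u p i)) /=.
rewrite ler_wpDr //; first by apply: sumr_ge0 => i _; apply: sumr_ge0.
apply: ler_sum => i /andP[_ /retained_sign ret_i].
by rewrite normrM ret_i mul1r; exact: box_indic_dist.
Qed.

End Grid.

(** * Expected exponential counts in the slabs *)

Lemma measurable_exp_count (R : realType) (dO dT : measure_display)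
    (Omega : measurableType dO) (T : measurableType dT) (m : nat)
    (X : 'I_m -> Omega -> T) (S : set T) :
  (forall i, measurable_fun [set: Omega] (X i)) -> measurable S ->
  measurable_fun [set: Omega] (fun o => (expR (\sum_i \1_S (X i o)) : R)%:E).
Proof.
move=> mX mS; apply/measurable_EFinP; apply: measurableT_comp => //.
apply: measurable_sum => i.
rewrite (_ : (fun o => _) = \1_(X i @^-1` S)) //; apply: measurable_indic.
by rewrite -[_ @^-1` _]setTI; exact: mX.
Qed.

(** Summing over all $d(N+1)$ slabs replaces a maximum over boxes and makes linearity available. *)
Lemma slab_integral_le (R : realType) (d N m : nat) (q : 'I_d -> 'I_N -> R)
    (dO : measure_display) (Omega : measurableType dO) (P : probability Omega R)
    (x : 'I_m -> Omega -> borelRV R d) (p : R) :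
  (forall i, measurable_fun [set: Omega] (x i)) ->
  mutually_independent P x ->
  (forall i j k, P (x i @^-1` slab q j k) <= p%:E)%E ->
  (\int[P]_o (\sum_j \sum_(k < N.+1) expR (\sum_i \1_(slab q j k) (x i o)))%:E
     <= ((d * N.+1)%:R * expR (m%:R * p * (expR 1 - 1)))%:E)%E.
Proof.
move=> mx indx slabp.
under eq_integral do rewrite -sumEFin.
rewrite ge0_integral_sum //; last 2 first.
- move=> j; apply/measurable_EFinP; apply: measurable_sum => k; apply/measurable_EFinP.
  exact: measurable_exp_count (measurable_slab _ _ _).
- by move=> j o _; rewrite lee_fin sumr_ge0 // => k _; exact: expR_ge0.
rewrite natrM -mulrA mulr_natl -[X in _ *+ X]card_ord -sumr_const -sumEFin.
apply: lee_sum => j _.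
under eq_integral do rewrite -sumEFin.
rewrite ge0_integral_sum //; last first.
  by move=> k; exact: measurable_exp_count (measurable_slab _ _ _).
rewrite mulr_natl -[X in _ *+ X]card_ord -sumr_const -sumEFin.
apply: lee_sum => k _.
by apply: exponential_moment_le => //; exact: measurable_slab.
Qed.

(** * Choice of parameters and conclusion *)

Theorem proposition1 (R : realType) :
  exists C1 : R, 0 < C1 /\
  forall (n m d : nat) (T : R) (mu : probability (borelRV R d) R)
    (dO : measure_display) (Omega : measurableType dO) (P : probability Omega R)
    (x : 'I_m -> {RV P >-> borelRV R d}) (eps : 'I_m -> {RV P >-> R}),
  (1 <= n)%N -> (1 <= m)%N -> (1 <= d)%N -> (m <= 2 * n)%N -> 0 < T ->
  mutually_independent P (fun i => x i : Omega -> borelRV R d) ->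
  (forall i, has_law (x i) mu) ->
  mutually_independent P (fun i => eps i : Omega -> R) ->
  (forall i, rademacher (eps i)) ->
  independent P (fun o => [tuple x i o | i < m]) (fun o => [tuple eps i o | i < m]) ->
  exists A : online_algorithm R d,
    ('E_(P \x rand_law A)[fun z : Omega * rand_space A =>
        (discarded_count z.2 (fun i => (x i z.1, eps i z.1)))%:R]
      <= (2 * n%:R / T)%:E)%E /\
    (\int[P \x rand_law A]_z
        sup_disc z.2 (fun i => (x i z.1, eps i z.1))
      <= (T * log2 n%:R ^+ (2 * d) + d%:R * ln (d * n)%:R + C1 * d%:R)%:E)%E.
Proof.
(* The 4 bounds $m/(N+1)$, as $m \le 2n$ and $n \le 2(N+1)$. *)
exists (expR (4 * (expR 1 - 1))); split; first exact: expR_gt0.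
move=> n m d T mu dO Omega P x eps n1 m1 d1 mn T0 x_indep x_law eps_indep eps_rad x_eps.
pose L := trunc_log 2 n; pose N := (2 ^ L).-1.
have N2 : N.+1 = (2 ^ L)%N by rewrite prednK // expn_gt0.
have Nn : (N.+1 <= n)%N by rewrite N2 trunc_logP.
have nN : (n <= 2 * N.+1)%N by rewrite N2 -expnS ltnW // trunc_log_ltn.
have L_log : L%:R <= log2 n%:R :> R.
  rewrite /log2 ler_pdivlMr ?ln_gt0 ?ltr1n // mulr_natl -lnXn //.
  by rewrite ler_ln ?posrE ?exprn_gt0 ?ltr0n // -natrX ler_nat -N2.
(* $K \le T L^d$ serves the discrepancy and $K+1 \ge T L^d$ the discards. *)
pose K := Num.truncn (T * (L ^ d)%:R).
have TL0 : 0 <= T * (L ^ d)%:R by rewrite mulr_ge0 // ltW.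
have K_le : K%:R <= T * (L ^ d)%:R by rewrite truncn_le.
have K_gt : T * (L ^ d)%:R <= K.+1%:R by rewrite ltW // truncnS_gt.
have /choice[q qP] : forall j : 'I_d, exists q : 'I_N -> R,
    forall k, (mu (coordinate j @^-1` strip q k) <= (N.+1%:R^-1)%:E)%E.
  by move=> j; exact: (@has_quantile_grid _ _ _ mu (coordinate j) N).
have slab_le i j k : (P (x i @^-1` slab q j k) <= (N.+1%:R^-1)%:E)%E.
  have := x_law i _ (measurable_slab q j k).
  by rewrite /distribution /pushforward => ->; exact: qP.
have [W W_le] := exists_initial_state K (measurable_cell q)
  (@card_in_dbox d L N) eps_indep eps_rad x_eps.
exists (thinning (@in_dbox d L N) (measurable_cell q) W); split.
  pose f o : \bar R := (discarded_count
    (tt : rand_space (thinning (@in_dbox d L N) (measurable_cell q) W))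
    (fun i => (x i o, eps i o)))%:R%:E.
  apply: (@le_trans _ _ (\int[P \x (\d_tt : probability unit R)]_z f z.1)%E).
    rewrite unlock le_eqVlt; apply/orP; left; apply/eqP.
    by apply: eq_integral => -[w []].
  rewrite integral_prod_dirac; last 2 first.
  - exact: measurable_discarded_count.
  - by move=> w; rewrite lee_fin.
  apply: le_trans W_le _; rewrite lee_fin ler_pdivrMr // natrM.
  rewrite -[leRHS](mulrA (2 * n%:R)) ler_pM //.
    by rewrite -natrM ler_nat.
  by rewrite mulrC ler_pdivlMr // mulrC.
pose A := thinning (@in_dbox d L N) (measurable_cell q) W.
pose E o : R := \sum_j \sum_(k < N.+1) expR (\sum_i \1_(slab q j k) (x i o)).
pose c : R := T * log2 n%:R ^+ (2 * d) + d%:R * ln n%:R.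
pose g o : \bar R := (c + n%:R^-1 * E o)%:E.
have disc_g (u : rand_space A) o k b :
    disc u (fun i => (x i o, eps i o)) k (box b) <= c + n%:R^-1 * E o.
  apply: le_trans (disc_le N2 u _ k b) _; rewrite /c -addrA lerD //.
    rewrite -mulr_natr (le_trans (ler_wpM2r _ K_le)) // -mulrA ler_wpM2l ?(ltW T0) //.
    rewrite -natrM -expnD addnn -mul2n natrX lerXn2r ?nnegrE ?(le_trans _ L_log) //.
  rewrite /E mulr_sumr -[d in d%:R](card_ord d) mulr_natl -sumr_const -big_split /=.
  apply: ler_sum => j _; set N' := \sum_i _.
  (* This is $y \le e^y$ at $y = N' - \ln n$; the right side is one term of the sum [E]. *)
  have N'_le : N' - ln n%:R <= n%:R^-1 * expR N'.
    apply: le_trans (_ : expR (N' - ln n%:R) <= _).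
      by rewrite (le_trans _ (expR_ge1Dx _)) // lerDr.
    by rewrite expRB lnK ?posrE ?ltr0n // mulrC.
  rewrite -lerBlDl (le_trans N'_le) // ler_wpM2l ?invr_ge0 //.
  by rewrite (bigD1 (box_cell q b j)) //= lerDl sumr_ge0 // => k' _; exact: expR_ge0.
apply: (@le_trans _ _ (\int[P \x (\d_tt : probability unit R)]_z g z.1)%E).
  apply: ge0_le_integral_nonmeasurable => z.
    (* The supremum is nonnegative because $m \ge 1$ allows the time 1, with any box. *)
    apply: ereal_sup_ge.
    exists (disc z.2 (fun i => (x i z.1, eps i z.1)) 1 (box 0))%:E; last first.
      by rewrite lee_fin normr_ge0.
    by exists 0, 1%N.
  by apply: ge_ereal_sup => _ [b [k [_ ->]]]; rewrite lee_fin.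
have c0 : 0 <= c.
  by rewrite addr_ge0 ?mulr_ge0 ?(ltW T0) ?exprn_ge0 ?ln_ge0 ?ler1n ?(le_trans _ L_log).
have E0 o : 0 <= E o by do 2 apply: sumr_ge0 => ? _; exact: expR_ge0.
have mE : measurable_fun [set: Omega] (EFin \o E).
  apply/measurable_EFinP; apply: measurable_sum => j; apply: measurable_sum => k.
  by apply/measurable_EFinP; apply: measurable_exp_count => //; exact: measurable_slab.
rewrite integral_prod_dirac /g; last 2 first.
- apply/measurable_EFinP; apply: measurable_funD => //.
  by apply: measurable_funM => //; exact/measurable_EFinP.
- by move=> o; rewrite lee_fin addr_ge0 // mulr_ge0.
under eq_integral do rewrite EFinD EFinM.
rewrite ge0_integralD //; last 2 first.
- by move=> o _; rewrite -EFinM lee_fin mulr_ge0.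
- exact: measurable_funeM.
rewrite integral_cst // [X in (_ * X + _)%E](probability_setT P) mule1.
rewrite ge0_integralZl_EFin //; last first.
  by move=> o _; rewrite lee_fin.
apply: (@le_trans _ _ (c%:E + n%:R^-1%:E *
   ((d * N.+1)%:R * expR (m%:R * N.+1%:R^-1 * (expR 1 - 1)))%:E)%E).
  rewrite leeD2l // lee_wpmul2l ?lee_fin ?invr_ge0 //.
  exact: slab_integral_le.
rewrite -EFinM -EFinD lee_fin /c -!addrA lerD2l lerD //.
  rewrite ler_wpM2l // ler_ln ?posrE ?ltr0n // ?muln_gt0 ?d1 //.
  by rewrite ler_nat leq_pmull.
(* The $N+1 \le n$ slabs per axis cancel the factor $1/n$. *)
rewrite mulrA [leRHS]mulrC ler_pM ?expR_ge0 ?mulr_ge0 ?invr_ge0 //.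
  by rewrite natrM mulrCA ler_piMr // mulrC ler_pdivrMr ?ltr0n // mul1r ler_nat.
rewrite ler_expR ler_wpM2r //.
rewrite ler_pdivrMr // -natrM ler_nat; lia.
Qed.
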